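(* Suppose $\{ t_{n} \}_{n\in\mathbb{Z}} \subset \mathbb{R}$ is a set of sampling for $PW_{2\pi}$. Then the mapping $\widetilde{\mathcal{A}} : PW_{\pi}/\!\sim\ \to \ell^{2}(\mathbb{Z}) \oplus \ell^{2}(\mathbb{Z})$, $[f] \mapsto ( | f(t_{n})|, | f^{\prime}(t_{n})|)_{n\in\mathbb{Z}}$, is one-to-one. Equivalently, if $f,g\in PW_\pi$ satisfy $|f(t_n)|=|g(t_n)|$ and $|f'(t_n)|=|g'(t_n)|$ for all $n\in\mathbb{Z}$, then there is $\lambda\in\mathbb{C}$ with $|\lambda|=1$ such that $f=\lambda g$ or $f=\lambda g^\sharp$.
   Context: For $\gamma>0$, $PW_{\gamma}$ is the space of $f \in L^2(\mathbb{R})$ whose Fourier transform $\hat f(\xi)=\int_{\mathbb{R}} f(x)e^{-ix\xi}\,dx$ vanishes a.e. outside $[-\gamma,\gamma]$; each such $f$ extends to an entire function. For entire $f$, $f^{\sharp}(z) = \overline{f(\bar z)}$. The equivalence relation $\sim$ on $PW_\pi$ is: $f\sim g$ iff $f=\lambda g$ or $f=\lambda g^\sharp$ for some $\lambda\in\mathbb{C}$ with $|\lambda|=1$; $[f]$ denotes the class of $f$. A sequence $\{t_n\}\subset\mathbb{R}$ is a set of sampling for $PW_{2\pi}$ if there are constants $A,B>0$ with $A\|f\|^2\le \sum_n |f(t_n)|^2 \le B\|f\|^2$ for all $f\in PW_{2\pi}$. *)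

(* Defs.v *)
From HB Require Import structures.
From mathcomp Require Import all_boot all_order all_algebra.
From mathcomp Require Import all_classical all_reals all_analysis.
From mathcomp Require Import complex.
Set Implicit Arguments. Unset Strict Implicit. Unset Printing Implicit Defensive.
Import Order.TTheory GRing.Theory Num.Theory.
Import numFieldNormedType.Exports.
Local Open Scope classical_set_scope.
Local Open Scope ring_scope.

Section PW.
Variable R : realType.
Local Notation C := (R[i]).

Definition cmod (z : C) : R := Num.sqrt (complex.Re z ^+ 2 + complex.Im z ^+ 2).

Definition cexp (w : C) : C :=
  (expR (complex.Re w))%:C%C * ((cos (complex.Im w))%:C%C + 'i%C * (sin (complex.Im w))%:C%C).

Definition cintegral (a b : R) (F : R -> C) : C :=
  (Rintegral lebesgue_measure `[a, b] (fun x => complex.Re (F x)))%:C%C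
  + 'i%C * (Rintegral lebesgue_measure `[a, b] (fun x => complex.Im (F x)))%:C%C.

Definition L2_on (g : R) (F : R -> C) : Prop :=
  measurable_fun `[(- g)%R, g] (fun x => complex.Re (F x)) /\
  measurable_fun `[(- g)%R, g] (fun x => complex.Im (F x)) /\
  (\int[lebesgue_measure]_(x in `[(- g)%R, g]) ((cmod (F x)) ^+ 2)%:E < +oo)%E.

(* Paley--Wiener space PW_g, viewed through the entire extension of its
   elements: f is the inverse Fourier transform of some F in L^2[-g,g],
   f(z) = (1/2pi) \int_{-g}^{g} F(xi) e^{i z xi} dxi  for all z in C. *)
Definition PW (g : R) (f : C -> C) : Prop :=
  exists F : R -> C, L2_on g F /\
    forall z : C, f z = (2 * pi)^-1%:C%C *
      cintegral (- g) g (fun xi => F xi * cexp ('i%C * z * xi%:C%C)).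

Definition fsharp (f : C -> C) : C -> C := fun z => conjc (f (conjc z)).

(* derivative of f along the real axis at the real point t
   (for entire f this is f'(t)) *)
Definition rderiv (f : C -> C) (t : R) : C :=
  (derive1 (fun x : R => complex.Re (f x%:C%C)) t)%:C%C
  + 'i%C * (derive1 (fun x : R => complex.Im (f x%:C%C)) t)%:C%C.

Definition L2norm2 (f : C -> C) : \bar R :=
  (\int[lebesgue_measure]_(x in [set: R]) ((cmod (f x%:C%C)) ^+ 2)%:E)%E.

Definition sampling_set (g : R) (t : int -> R) : Prop :=
  exists A B : R, 0 < A /\ 0 < B /\
    forall f : C -> C, PW g f ->
      (A%:E * L2norm2 f <= \esum_(n in [set: int]) ((cmod (f (t n)%:C%C)) ^+ 2)%:E)%E /\
      (\esum_(n in [set: int]) ((cmod (f (t n)%:C%C)) ^+ 2)%:E <= B%:E * L2norm2 f)%E.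

End PW.

(* Main.v *)
(** For [f], [g] in PW_pi the functions f f# - g g# and f' f'# - g' g'# lie in
    PW_2pi: their symbols are convolutions of symbols in L^2[-pi, pi].  They
    vanish at the sampling points, hence on the real line, so |f| = |g| and
    |f'| = |g'| there.  Put u = f' f# and v = g' g#.  On the real line
    Re u = (|f|^2)'/2 = Re v and |u| = |v|, so
    (Im u - Im v) (Im u + Im v) = 0; both factors are restrictions of elements
    of PW_2pi, so one of them vanishes identically.  If u = v, then f/g has zero
    derivative near any real point where g does not vanish, hence f = lam g
    near it and everywhere; if u = v#, the same applies to f and g#.

    The identity theorem used twice above is proved on the symbol side: if f
    vanishes near a real point x0, all moments of F(xi) e^{i x0 xi} vanish, and
    expanding the exponential kernel under the integral sign gives f = 0. *)

Require Import Defs.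
From HB Require Import structures.
From mathcomp Require Import all_boot all_order all_algebra.
From mathcomp Require Import all_classical all_reals all_analysis.
From mathcomp Require Import measurable_realfun complex ring lra.
Set Implicit Arguments. Unset Strict Implicit. Unset Printing Implicit Defensive.
Import Order.TTheory GRing.Theory Num.Theory.
Import numFieldNormedType.Exports.
Local Open Scope classical_set_scope.
Local Open Scope ring_scope.

(** * Square-integrable functions with compact support *)

Section SquareIntegrable.
Context {R : realType}.
Local Notation mu := (@lebesgue_measure R).
Implicit Types (a b p q phi : R -> R) (g x : R).

Definition sqi a := measurable_fun setT a /\
  mu.-integrable setT (EFin \o (fun x => a x ^+ 2)).

(** The support condition is pointwise, not almost everywhere, so that supports of products and of
    convolutions can be computed at every point. *)
Definition sqs g a := sqi a /\ forall x, g < `|x| -> a x = 0.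

Lemma integrable_le a b : measurable_fun setT a ->
  mu.-integrable setT (EFin \o b) -> (forall x, `|a x| <= b x) ->
  mu.-integrable setT (EFin \o a).
Proof.
move=> ma ib ab; apply: (le_integrable measurableT _ _ ib) => //.
- exact/measurable_EFinP.
- by move=> x _ /=; rewrite lee_fin (le_trans (ab x))// ler_norm.
Qed.

Lemma integrable_addR a b : mu.-integrable setT (EFin \o a) ->
  mu.-integrable setT (EFin \o b) ->
  mu.-integrable setT (EFin \o (fun x => a x + b x)).
Proof.
move=> ia ib; rewrite (_ : _ \o _ = (EFin \o a) \+ (EFin \o b))%E; last first.
  by apply/funext => x /=.
exact: integrableD.
Qed.

Lemma integrable_scaleR k a : mu.-integrable setT (EFin \o a) ->
  mu.-integrable setT (EFin \o (fun x => k * a x)).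
Proof.
move=> ia.
rewrite (_ : _ \o _ = (fun x => k%:E * (EFin \o a) x))%E; last first.
  by apply/funext => x /=.
exact: integrableZl.
Qed.

Lemma integrable_oppR a : mu.-integrable setT (EFin \o a) ->
  mu.-integrable setT (EFin \o (fun x => - a x)).
Proof.
move=> /(integrable_scaleR (-1)); under [fun x => -1 * _]eq_fun do rewrite mulN1r.
exact.
Qed.

(** Pointwise |a b| <= a^2 + b^2, and the right side is integrable. *)
Lemma sqi_mul a b : sqi a -> sqi b ->
  mu.-integrable setT (EFin \o (fun x => a x * b x)).
Proof.
move=> [ma ia] [mb ib]; apply: integrable_le (integrable_addR ia ib) _.
  exact: measurable_funM.
by move=> x; rewrite ler_norml; apply/andP; split; nra.
Qed.

Lemma sqi_le a b : measurable_fun setT a -> sqi b ->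
  (forall x, `|a x| <= `|b x|) -> sqi a.
Proof.
move=> ma [mb ib] ab; split => //; apply: integrable_le ib _.
  exact: measurable_funX.
move=> x; rewrite normrX -[leRHS]real_normK ?num_real//.
by rewrite lerXn2r ?nnegrE.
Qed.

Lemma sqiD a b : sqi a -> sqi b -> sqi (fun x => a x + b x).
Proof.
move=> sa sb; have [[ma ia] [mb ib]] := (sa, sb); split.
  exact: measurable_funD.
have := integrable_addR (integrable_addR ia ib) (integrable_scaleR 2 (sqi_mul sa sb)).
by congr (mu.-integrable _ _); apply/funext => x /=; congr EFin; ring.
Qed.

Lemma sqiZ k a : sqi a -> sqi (fun x => k * a x).
Proof.
move=> [ma ia]; split; first exact: measurable_funM.
have := integrable_scaleR (k ^+ 2) ia.
by congr (mu.-integrable _ _); apply/funext => x /=; congr EFin; ring.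
Qed.

Lemma sqsD g a b : sqs g a -> sqs g b -> sqs g (fun x => a x + b x).
Proof.
by move=> [sa a0] [sb b0]; split=> [|x gx]; [exact: sqiD|rewrite a0// b0// addr0].
Qed.

Lemma sqsZ g k a : sqs g a -> sqs g (fun x => k * a x).
Proof.
by move=> [sa a0]; split=> [|x gx]; [exact: sqiZ|rewrite a0// mulr0].
Qed.

Lemma sqsN g a : sqs g a -> sqs g (fun x => - a x).
Proof. by move=> /(sqsZ (-1)); under eq_fun do rewrite mulN1r. Qed.

Lemma sqsB g a b : sqs g a -> sqs g b -> sqs g (fun x => a x - b x).
Proof. by move=> sa sb; exact/sqsD/sqsN. Qed.

Lemma sqs_indic g : sqs g (\1_(`[- g, g]) : R -> R).
Proof.
split; last first.
  move=> x gx; rewrite indicE memNset//= in_itv/= -ler_norml.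
  by apply/negP; rewrite -ltNge.
split; first exact: measurable_indic.
rewrite (_ : _ \o _ = EFin \o (\1_(`[- g, g]) : R -> R)); last first.
  by apply/funext => x /=; rewrite indicE; case: (_ \in _); rewrite ?expr1n ?expr0n.
exact: integrable_indic_itv.
Qed.

Lemma sqs_bounded g a : measurable_fun setT a ->
  (forall x, g < `|x| -> a x = 0) -> (exists M, forall x, `|a x| <= M) -> sqs g a.
Proof.
move=> ma a0 [M aM]; split=> //.
apply: (sqi_le ma (sqiZ M (sqs_indic g).1)) => x.
have [xg|gx] := leP `|x| g; last by rewrite a0// normr0.
rewrite indicE mem_set/= ?in_itv/= -?ler_norml// mulr1.
exact: le_trans (aM x) (ler_norm M).
Qed.

(** On its support [a] equals its product with the indicator of [-g, g], and both factors are square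
    integrable. *)
Lemma sqs_integrable g a : sqs g a -> mu.-integrable setT (EFin \o a).
Proof.
move=> [sa a0]; have := sqi_mul sa (sqs_indic g).1.
congr (mu.-integrable _ _); apply/funext => x /=; congr EFin.
have [xg|gx] := leP `|x| g; last by rewrite a0// mul0r.
by rewrite indicE mem_set/= ?in_itv/= -?ler_norml// mulr1.
Qed.

(** Only the values of [phi] on the compact interval [-g, g] matter, and there it is bounded. *)
Lemma sqsM g a phi : sqs g a -> continuous phi -> sqs g (fun x => a x * phi x).
Proof.
move=> [sa a0] cphi; split; last by move=> x gx; rewrite a0// mul0r.
have mphi : measurable_fun setT phi by exact: continuous_measurable_fun.
have [M phiM] : exists M, forall x, `|x| <= g -> `|phi x| <= M.
  have : compact (phi @` `[- g, g]).
    apply: continuous_compact; last exact: segment_compact.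
    exact: continuous_subspaceT.
  move=> /compact_bounded[M [_ /(_ (M + 1))]] /=; rewrite ltrDl ltr01 => /(_ isT) hM.
  exists (M + 1) => x xg; apply: hM; exists x => //=.
  by rewrite in_itv/= -ler_norml.
apply: (@sqi_le _ (fun x => M * a x)).
- by apply: measurable_funM => //; case: sa.
- exact: sqiZ.
- move=> x; have [xg|gx] := leP `|x| g; last by rewrite a0// mul0r mulr0.
  rewrite !normrM mulrC ler_wpM2r//.
  exact: le_trans (phiM x xg) (ler_norm M).
Qed.

Lemma sqs_integrableM g a phi : sqs g a -> continuous phi ->
  mu.-integrable setT (EFin \o (fun x => a x * phi x)).
Proof. by move=> sa cphi; apply: (@sqs_integrable g); exact: sqsM. Qed.

End SquareIntegrable.

(** * Convolution *)

Section Convolution.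
Context {R : realType}.
Local Notation mu := (@lebesgue_measure R).
Implicit Types (a b p q phi : R -> R) (g d x s : R).

(** * Invariance of Lebesgue measure under reflections and translations *)

Lemma measurable_refl s : measurable_fun setT (fun x : R => s - x).
Proof. by apply: measurable_funB. Qed.

Lemma lebesgue_measure_refl s (A : set R) : measurable A ->
  pushforward mu ((fun x => s - x) : _ -> measurableTypeR R) A = mu A.
Proof.
move=> mA; apply/esym/lebesgue_measure_unique => //=; first exact: measurable_refl.
move=> _ _ [[a b]] _ <-; rewrite /pushforward.
(* Uniqueness of the measure is tested on intervals ]a, b]; the reflection exchanges the open and
   the closed end and keeps the length. *)
rewrite (_ : _ @^-1` _ = `[s - b, s - a[%classic); last first.
  apply/seteqP; split=> x /=; rewrite !in_itv/=.
    by move=> /andP[? ?]; apply/andP; split; lra.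
  by move=> /andP[? ?]; apply/andP; split; lra.
rewrite !lebesgue_measure_itv/= !lte_fin ltrD2l ltrN2.
by case: ifP => // _; rewrite -!EFinB; congr EFin; ring.
Qed.

(** The nonnegative case comes first: applied to |a| it yields the integrability that the signed
    change of variables in [Rintegral_refl] requires. *)
Lemma ge0_integral_refl s (f : R -> \bar R) : measurable_fun setT f ->
  (forall x, 0 <= f x)%E ->
  (\int[mu]_x f (s - x)%R = \int[mu]_x f x)%E.
Proof.
move=> mf f0; have := @ge0_integral_pushforward _ _ (measurableTypeR R) (measurableTypeR R) R
  (fun x => s - x) (measurable_refl s) mu setT f measurableT mf (fun x _ => f0 x).
rewrite preimage_setT => <-.
apply: eq_measure_integral => //=; first exact: measurable_refl.
by move=> _ A mA _; exact: lebesgue_measure_refl.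
Qed.

Lemma integrable_refl s a : mu.-integrable setT (EFin \o a) ->
  mu.-integrable setT (EFin \o (fun x => a (s - x))).
Proof.
move=> /integrableP[/measurable_EFinP ma ia]; apply/integrableP; split.
  by apply/measurable_EFinP/measurableT_comp => //; exact: measurable_refl.
rewrite (ge0_integral_refl s (f := fun x => `|(a x)%:E|%E))//.
exact/measurableT_comp/measurable_EFinP.
Qed.

Lemma Rintegral_refl s a : mu.-integrable setT (EFin \o a) ->
  (\int[mu]_x a (s - x) = \int[mu]_x a x)%R.
Proof.
move=> ia; have /integrableP[ma _] := ia; congr fine.
have := @integral_pushforward _ _ (measurableTypeR R) (measurableTypeR R) R
  (fun x => s - x) (measurable_refl s) mu setT (EFin \o a) ma.
rewrite preimage_setT => /(_ (integrable_refl s ia) measurableT) /= <-.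
apply: eq_measure_integral => //=; first exact: measurable_refl.
by move=> _ A mA _; exact: lebesgue_measure_refl.
Qed.

(** A translation is the composition of two reflections. *)
Lemma integrable_shift s a : mu.-integrable setT (EFin \o a) ->
  mu.-integrable setT (EFin \o (fun x => a (x - s))).
Proof.
move=> /(integrable_refl 0)/(integrable_refl s).
by congr (mu.-integrable _ _); apply/funext => x /=; congr (EFin (a _)); ring.
Qed.

Lemma Rintegral_shift s a : mu.-integrable setT (EFin \o a) ->
  (\int[mu]_x a (x - s) = \int[mu]_x a x)%R.
Proof.
move=> ia; rewrite -(Rintegral_refl 0 ia) -(Rintegral_refl s (integrable_refl 0 ia)).
by apply: eq_Rintegral => x _; congr (a _); ring.
Qed.

Lemma sqi_refl s a : sqi a -> sqi (fun x => a (s - x)).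
Proof.
move=> [ma ia]; split; last exact: (integrable_refl s ia).
by apply: measurableT_comp => //; exact: measurable_refl.
Qed.

Lemma sqs_oppx g a : sqs g a -> sqs g (fun x => a (- x)).
Proof.
move=> [sa a0]; split; last by move=> x gx; rewrite a0// normrN.
by have := sqi_refl 0 sa; under [X in sqi X]eq_fun do rewrite sub0r.
Qed.

Definition convol p q s : R := (\int[mu]_x (p x * q (s - x)))%R.

(* The integral defining [convol] converges at every [s], not only almost
   everywhere, because both factors are square integrable. *)
Lemma conv_integrable p q s : sqi p -> sqi q ->
  mu.-integrable setT (EFin \o (fun x => p x * q (s - x))).
Proof. by move=> sp sq; apply: sqi_mul => //; exact: sqi_refl. Qed.

Let K p q (xs : measurableTypeR R * measurableTypeR R) : \bar R :=
  (p xs.1 * q (xs.2 - xs.1))%:E.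

(** Tonelli: the double integral of |p(x) q(s - x)| is the product of the L^1 norms of p and q. *)
Let intK p q : measurable_fun setT p -> measurable_fun setT q ->
  mu.-integrable setT (EFin \o p) -> mu.-integrable setT (EFin \o q) ->
  ((mu \x mu)%E).-integrable setT (K p q).
Proof.
move=> mp mq ip iq.
have mK : measurable_fun setT (K p q).
  apply/measurable_EFinP/measurable_funM; first exact: measurableT_comp.
  by apply: measurableT_comp => //; apply: measurable_funB.
apply/(integrable12ltyP mu mu mK); rewrite /K /=.
under eq_integral => x _.
  under eq_integral do rewrite normrM EFinM.
  rewrite ge0_integralZl//; last first.
    apply/measurable_EFinP; do 2 apply: measurableT_comp => //.
    exact: measurable_funB.
  over.
have /integrableP[_ /= pfin] := ip.
(* By translation invariance the inner integral does not depend on x. *)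
have [r r0 qr] : exists2 r : R, 0 <= r &
    forall x, (\int[mu]_y `|q (y - x)|%:E = r%:E)%E.
  exists (\int[mu]_y `|q y|)%R; first exact: Rintegral_ge0.
  move=> x; have iq' : mu.-integrable setT (EFin \o (fun y => `|q y|)).
    exact: integrable_norm iq.
  rewrite -(Rintegral_shift x iq') fineK//.
  exact: integrable_fin_num (integrable_shift x iq').
under eq_integral do rewrite qr.
rewrite ge0_integralZr//; last first.
  by apply/measurable_EFinP/measurableT_comp.
rewrite lte_mul_pinfty ?ltry// ?integral_ge0//.
by rewrite ge0_fin_numE// integral_ge0.
Qed.

(** Square integrability comes from boundedness and compact support; measurability in s comes from
    Fubini's theorem. *)
Lemma sqs_conv g d p q : sqs g p -> sqs d q -> sqs (g + d) (convol p q).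
Proof.
move=> sp sq; have [[[mp ip] p0] [[mq iq] q0]] := (sp, sq).
have iK := intK mp mq (sqs_integrable sp) (sqs_integrable sq).
apply: sqs_bounded.
- have := measurable_fubini_G iK => mG.
  exact: (measurableT_comp (fine_measurable measurableT) mG).
- move=> s gds; transitivity (\int[mu]_(x in setT) (0 : R))%R; last first.
    by rewrite Rintegral_cst// mul0r.
  apply: eq_Rintegral => x _; have [xg|gx] := leP `|x| g; last by rewrite p0// mul0r.
  (* If |x| <= g and |s| > g + d, then |s - x| > d. *)
  rewrite [q _]q0 ?mulr0//; have := ler_normD x (s - x).
  by rewrite addrC subrK => ?; lra.
(* The bound is uniform in s: |p(x) q(s - x)| <= p(x)^2 + q(s - x)^2, and reflection preserves the
   integral of q^2. *)
- exists (\int[mu]_x (p x ^+ 2) + \int[mu]_x (q x ^+ 2))%R => s.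
  rewrite -(Rintegral_refl s iq) -RintegralD//; last exact: integrable_refl iq.
  have icv := conv_integrable s sp.1 sq.1.
  apply: le_trans (le_normr_Rintegral measurableT icv) _.
  apply: le_Rintegral => //.
  + exact: integrable_norm icv.
  + apply: integrable_addR => //; exact: integrable_refl iq.
  + by move=> x _; rewrite ler_norml; apply/andP; split; nra.
Qed.

Lemma Rintegral_conv g d p q : sqs g p -> sqs d q ->
  (\int[mu]_s convol p q s = \int[mu]_x p x * \int[mu]_x q x)%R.
Proof.
move=> sp sq; have [[[mp ip] p0] [[mq iq] q0]] := (sp, sq).
have iP := sqs_integrable sp; have iQ := sqs_integrable sq.
rewrite -RintegralZr//; congr fine.
transitivity (\int[mu]_s \int[mu]_x K p q (x, s))%E.
  apply: eq_integral => s _; rewrite /convol fineK//.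
  exact/integrable_fin_num/conv_integrable/sq.1.
rewrite -Fubini; last exact: intK.
apply: eq_integral => x _; rewrite /K/=.
rewrite -(Rintegral_shift x iQ) -RintegralZl//; last exact: integrable_shift.
rewrite fineK//; apply: integrable_fin_num => //.
exact/integrable_scaleR/integrable_shift.
Qed.

End Convolution.

(** * Integrals against exponential kernels *)

Section FourierKernels.
Context {R : realType}.
Local Notation mu := (@lebesgue_measure R).
Implicit Types (a phi dphi : R -> R) (g x y : R).

Lemma continuous_scale phi x : continuous phi -> continuous (fun xi => phi (x * xi)).
Proof.
move=> cphi xi; apply: (@continuous_comp _ _ _ (fun xi => x * xi) phi).
  exact: mulrl_continuous.
exact: cphi.
Qed.

(** Differentiation under the integral sign. Since |phi'| <= 1, the x-derivative of the integrand is
    dominated by |a(xi) xi|, which is integrable because [a] has compact support. *)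
Lemma is_derive_Rintegral_scale g a phi dphi x : sqs g a ->
  (forall u : R, is_derive u 1 phi (dphi u)) -> (forall u, `|dphi u| <= 1) ->
  is_derive x 1 (fun x => \int[mu]_xi (a xi * phi (x * xi)))%R
    (\int[mu]_xi (a xi * xi * dphi (x * xi)))%R.
Proof.
move=> sa dphiE dphi1.
have cphi : continuous phi.
  by move=> u; apply/differentiable_continuous/derivable1_diffP; case: (dphiE u).
pose F (x : R) (xi : measurableTypeR R) : R := a xi * phi (x * xi).
have derF y (xi : R) : is_derive y 1 (F ^~ xi) (a xi * xi * dphi (y * xi)).
  rewrite /F.
  have h : is_derive y 1 (fun z : R => phi (z * xi)) (dphi (y * xi) * xi).
    apply: (is_derive1_comp (f := phi) (g := fun z => z * xi)).
    have := is_deriveM (f := id) (g := cst xi) (is_derive_id y 1) (is_derive_cst xi y 1).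
    by move/is_derive_eq; apply; rewrite /= scaler0 add0r /GRing.scale/= mulr1.
  have := is_deriveZ (a xi) h; rewrite /GRing.scale/=.
  by move/is_derive_eq; apply; ring.
pose G (xi : R) := `|a xi * xi|.
have G0 (xi : R) : 0 <= G xi by exact: normr_ge0.
have iG : mu.-integrable setT (EFin \o G).
  apply: (@integrable_norm _ _ _ mu setT (fun xi => a xi * xi)).
  by apply: (sqs_integrableM sa) => u; exact: cvg_id.
have intF y : mu.-integrable setT (EFin \o F y).
  by apply: (sqs_integrableM sa); exact: continuous_scale.
(* The dominating function does not depend on the parameter, so the radius 1 is arbitrary. *)
have Ix : `]x - 1, x + 1[%classic x by rewrite /= in_itv/=; apply/andP; split; lra.
have d1F y xi : partial1of2 F y xi = a xi * xi * dphi (y * xi).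
  by rewrite partial1of2E; case: (derF y xi).
have G_ub y (xi : measurableTypeR R) : `]x - 1, x + 1[%classic y -> setT xi ->
    `|partial1of2 F y xi| <= G xi.
  by move=> _ _; rewrite d1F /G normrM ler_piMr.
have dF (y xi : R) : `]x - 1, x + 1[%classic y -> setT xi ->
  derivable (F ^~ xi) y 1 by case: (derF y xi).
apply: DeriveDef.
  exact: (derivable_under_integral measurableT Ix (fun y _ => intF y) dF G0 iG G_ub).
rewrite -derive1E.
rewrite (differentiation_under_integral measurableT Ix (fun y _ => intF y) dF G0 iG G_ub).
by apply: eq_Rintegral => xi _; rewrite d1F.
Qed.

Lemma series_exp_coeff_le (u : R) n : 0 <= u -> series (exp_coeff u) n <= expR u.
Proof.
move=> u0; apply: nondecreasing_cvgn_le; last exact: is_cvg_series_exp_coeff.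
by apply: nondecreasing_series => k _ _; exact: exp_coeff_ge0.
Qed.

(** Integrate the power series of [phi] term by term. The bound r^k / k! is what the expansions of
    exp, cos and sin have in common, so one argument serves all three. *)
Lemma moments_eq0 g a (c : nat -> R) phi (r : R) : sqs g a ->
  (forall n, \int[mu]_xi (a xi * xi ^+ n) = 0)%R ->
  (forall k, `|c k| <= r ^+ k / k`!%:R) -> 0 <= r ->
  (forall xi, series (fun k => c k * xi ^+ k) @ \oo --> phi xi) ->
  continuous phi ->
  (\int[mu]_xi (a xi * phi xi) = 0)%R.
Proof.
move=> sa mom cr r0 cphi phic.
have cX n : continuous (fun xi : R => xi ^+ n) by move=> u; exact: exprn_continuous.
pose S n (xi : R) := series (fun k => c k * xi ^+ k) n.
have cS n : continuous (S n).
  elim: n => [|n IH] u.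
    rewrite (_ : S 0%N = cst 0); first exact: cvg_cst.
    by apply/funext => v; rewrite /S /series/= big_nil.
  rewrite (_ : S n.+1 = fun v => S n v + c n * v ^+ n); last first.
    by apply/funext => v; rewrite /S /series/= big_nat_recr.
  by apply: cvgD; [exact: IH|apply: cvgM; [exact: cvg_cst|exact: cX]].
have iS n : (\int[mu]_xi (a xi * S n xi) = 0)%R.
  elim: n => [|n IH].
    transitivity (\int[mu]_(x in setT) (0 : R))%R; last first.
      by rewrite Rintegral_cst// mul0r.
    by apply: eq_Rintegral => v _; rewrite /S /series/= big_nil mulr0.
  transitivity (\int[mu]_xi (a xi * S n xi + c n * (a xi * xi ^+ n)))%R.
    by apply: eq_Rintegral => v _; rewrite /S /series/= big_nat_recr//=; ring.
  rewrite RintegralD//; last 2 first.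
  - exact: sqs_integrableM sa (cS n).
  - exact/integrable_scaleR/(sqs_integrableM sa).
  by rewrite IH RintegralZl ?mom ?mulr0 ?addr0//; exact: (sqs_integrableM sa).
have [_ _ lim] : [/\ mu.-integrable setT (EFin \o (fun xi => a xi * phi xi)%R),
    [sequence \int[mu]_xi `|(a xi * S n xi)%:E - (a xi * phi xi)%:E|]_n @ \oo --> 0 &
    [sequence \int[mu]_xi (a xi * S n xi)%:E]_n @ \oo -->
      \int[mu]_xi (a xi * phi xi)%:E]%E.
  (* On the support |xi| <= g every partial sum is at most e^{r |xi|} <= e^{r g} in absolute value;
     outside it [a] vanishes. *)
  apply: (@dominated_convergence _ _ _ mu setT measurableT
    (fun n xi => (a xi * S n xi)%:E) (EFin \o (fun xi => a xi * phi xi))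
    (EFin \o (fun xi => `|expR (r * g) * a xi|))).
  - by move=> n; case/integrableP: (sqs_integrableM sa (cS n)).
  - by case/integrableP: (sqs_integrableM sa phic).
  - apply: aeW => xi _; apply: cvg_EFin; first exact: nearW.
    by apply: cvgM; [exact: cvg_cst|exact: cphi].
  - exact/integrable_norm/integrable_scaleR/(sqs_integrable sa).
  - apply: aeW => xi n _; rewrite lee_fin.
    have [xg|gx] := leP `|xi| g; last by rewrite sa.2// mul0r mulr0.
    rewrite !normrM mulrC ler_wpM2r// (ger0_norm (expR_ge0 _)).
    apply: le_trans (_ : expR (r * `|xi|) <= _); last first.
      by rewrite ler_expR ler_wpM2l.
    apply: le_trans (series_exp_coeff_le n _); last exact: mulr_ge0.
    apply: le_trans (ler_norm_sum _ _ _) _; apply: ler_sum => k _.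
    by rewrite /exp_coeff/= exprMn normrM normrX mulrAC ler_wpM2r// exprn_ge0.
(* [fine] also sends infinite values to 0, so integrability is needed to recover the extended-real
   integral from its vanishing real value. *)
have : (fun n => \int[mu]_xi (a xi * S n xi)%:E)%E = cst 0%E.
  apply/funext => n; have := iS n; rewrite /Rintegral => h.
  rewrite -[LHS]fineK ?h//; apply: integrable_fin_num => //.
  exact: sqs_integrableM sa (cS n).
move=> h; move: lim; rewrite /= h => /cvg_lim lim.
by rewrite /Rintegral -lim// lim_cst.
Qed.

Lemma moments_expR g a y : sqs g a ->
  (forall n, \int[mu]_xi (a xi * xi ^+ n) = 0)%R ->
  (\int[mu]_xi (a xi * expR (y * xi)) = 0)%R.
Proof.
move=> sa mom.
apply: (moments_eq0 (c := exp_coeff y) (r := `|y|) sa mom) => //.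
- by move=> k; rewrite /exp_coeff/= normrM normrX normfV normr_nat.
- move=> xi; rewrite (_ : (fun k => _) = exp_coeff (y * xi)).
    exact: is_cvg_series_exp_coeff.
  by apply/funext => k; rewrite /exp_coeff/= exprMn; ring.
- by apply: continuous_scale => u; exact: continuous_expR.
Qed.

Lemma moments_cos g a x : sqs g a ->
  (forall n, \int[mu]_xi (a xi * xi ^+ n) = 0)%R ->
  (\int[mu]_xi (a xi * cos (x * xi)) = 0)%R.
Proof.
move=> sa mom.
apply: (moments_eq0 (c := cos_coeff x) (r := `|x|) sa mom) => //.
- move=> k; rewrite /cos_coeff/= !normrM normfV !normrX normrN1 expr1n.
  rewrite mulr1 !normr_nat -mulrA.
  by case: odd; rewrite /= ?mul0r ?mul1r// divr_ge0// exprn_ge0.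
- move=> xi; rewrite (_ : (fun k => _) = cos_coeff (x * xi)).
    by rewrite unlock; exact: is_cvg_series_cos_coeff.
  by apply/funext => k; rewrite /cos_coeff/= exprMn; ring.
- by apply: continuous_scale => u; exact: continuous_cos.
Qed.

Lemma moments_sin g a x : sqs g a ->
  (forall n, \int[mu]_xi (a xi * xi ^+ n) = 0)%R ->
  (\int[mu]_xi (a xi * sin (x * xi)) = 0)%R.
Proof.
move=> sa mom.
apply: (moments_eq0 (c := sin_coeff x) (r := `|x|) sa mom) => //.
- move=> k; rewrite /sin_coeff/= !normrM normfV !normrX normrN1 expr1n.
  rewrite mulr1 !normr_nat -mulrA.
  by case: odd; rewrite /= ?mul0r ?mul1r// divr_ge0// exprn_ge0.
- move=> xi; rewrite (_ : (fun k => _) = sin_coeff (x * xi)).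
    by rewrite unlock; exact: is_cvg_series_sin_coeff.
  by apply/funext => k; rewrite /sin_coeff/= exprMn; ring.
- by apply: continuous_scale => u; exact: continuous_sin.
Qed.

End FourierKernels.

(** * Algebraic structure of Paley-Wiener spaces *)

Section PaleyWiener.
Context {R : realType}.
Local Notation mu := (@lebesgue_measure R).
Local Notation C := (R[i]).
Local Notation Re := (@complex.Re R).
Local Notation Im := (@complex.Im R).
Implicit Types (a b : R -> R) (g d x y xi : R) (F G P Q : R -> C) (z w : C)
  (f h : C -> C).

(** * Complex components, the exponential kernel and complex symbols *)

Lemma complex_ext z w : Re z = Re w -> Im z = Im w -> z = w.
Proof. by case: z w => [? ?] [? ?] /= -> ->. Qed.

Lemma cReD z w : Re (z + w) = Re z + Re w. Proof. by case: z w => [? ?] []. Qed.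
Lemma cImD z w : Im (z + w) = Im z + Im w. Proof. by case: z w => [? ?] []. Qed.
Lemma cReN z : Re (- z) = - Re z. Proof. by case: z. Qed.
Lemma cImN z : Im (- z) = - Im z. Proof. by case: z. Qed.
Lemma cReM z w : Re (z * w) = Re z * Re w - Im z * Im w.
Proof. by case: z w => [? ?] []. Qed.
Lemma cImM z w : Im (z * w) = Re z * Im w + Im z * Re w.
Proof. by case: z w => [? ?] []. Qed.
Lemma cReJ z : Re (conjc z) = Re z. Proof. by case: z. Qed.
Lemma cImJ z : Im (conjc z) = - Im z. Proof. by case: z. Qed.

Lemma cmod2E z : cmod z ^+ 2 = Re z ^+ 2 + Im z ^+ 2.
Proof. by rewrite /cmod sqr_sqrtr// addr_ge0 ?sqr_ge0. Qed.

Definition cint F : C :=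
  ((\int[mu]_x Re (F x))%R +i* (\int[mu]_x Im (F x))%R)%C.

Definition csqs g F := sqs g (Re \o F) /\ sqs g (Im \o F).

Definition ek z xi : C := cexp ('i%C * z * xi%:C%C).

Lemma Re_ek z xi : Re (ek z xi) = expR (- Im z * xi) * cos (Re z * xi).
Proof. by case: z => x y; rewrite /ek /cexp; simpc. Qed.

Lemma Im_ek z xi : Im (ek z xi) = expR (- Im z * xi) * sin (Re z * xi).
Proof. by case: z => x y; rewrite /ek /cexp; simpc. Qed.

Lemma ekD z w xi : ek (z + w) xi = ek z xi * ek w xi.
Proof.
apply: complex_ext.
  rewrite Re_ek cReM !Re_ek !Im_ek cReD cImD opprD !mulrDl expRD cosD; ring.
rewrite Im_ek cImM !Re_ek !Im_ek cReD cImD opprD !mulrDl expRD sinD; ring.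
Qed.

Lemma ek_add z xi (eta : R) : ek z (xi + eta) = ek z xi * ek z eta.
Proof.
apply: complex_ext.
  rewrite Re_ek cReM !Re_ek !Im_ek !mulrDr expRD cosD; ring.
rewrite Im_ek cImM !Re_ek !Im_ek !mulrDr expRD sinD; ring.
Qed.

Lemma ek_conj z xi : conjc (ek (conjc z) xi) = ek z (- xi).
Proof.
apply: complex_ext.
  by rewrite cReJ !Re_ek cReJ cImJ !mulrN cosN opprK mulNr opprK.
by rewrite cImJ !Im_ek cReJ cImJ !mulrN sinN opprK mulNr opprK mulrN.
Qed.

Lemma continuous_ek z : continuous (Re \o ek z) /\ continuous (Im \o ek z).
Proof.
have cE : continuous (fun xi => expR (- Im z * xi)).
  by apply: continuous_scale => u; exact: continuous_expR.
split.
  rewrite (_ : _ \o _ = fun xi => expR (- Im z * xi) * cos (Re z * xi)).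
    move=> u; apply: cvgM; first exact: cE.
    by apply: (@continuous_scale _ _ (Re z)); exact: continuous_cos.
  by apply/funext => xi /=; exact: Re_ek.
rewrite (_ : _ \o _ = fun xi => expR (- Im z * xi) * sin (Re z * xi)).
  move=> u; apply: cvgM; first exact: cE.
  by apply: (@continuous_scale _ _ (Re z)); exact: continuous_sin.
by apply/funext => xi /=; exact: Im_ek.
Qed.

Lemma csqsM g F (phi : R -> C) : csqs g F ->
  continuous (Re \o phi) /\ continuous (Im \o phi) ->
  csqs g (fun xi => F xi * phi xi).
Proof.
move=> [sr si] [cr ci]; split.
  rewrite (_ : _ \o _ = fun xi =>
      (Re \o F) xi * (Re \o phi) xi - (Im \o F) xi * (Im \o phi) xi).
    by apply: sqsB; exact: sqsM.
  by apply/funext => xi /=; exact: cReM.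
rewrite (_ : _ \o _ = fun xi =>
    (Re \o F) xi * (Im \o phi) xi + (Im \o F) xi * (Re \o phi) xi).
  by apply: sqsD; exact: sqsM.
by apply/funext => xi /=; exact: cImM.
Qed.

Lemma csqs_ek g F z : csqs g F -> csqs g (fun xi => F xi * ek z xi).
Proof. by move=> sF; apply: csqsM => //; exact: continuous_ek. Qed.

Lemma csqs_id g F : csqs g F -> csqs g (fun xi => F xi * xi%:C%C).
Proof.
move=> sF; apply: csqsM => //; split=> u; first exact: cvg_id.
by rewrite (_ : _ \o _ = cst 0)//; exact: cvg_cst.
Qed.

Lemma csqsZ g F z : csqs g F -> csqs g (fun xi => z * F xi).
Proof.
move=> sF; under eq_fun do rewrite mulrC.
by apply: csqsM => //; split => u; exact: cvg_cst.
Qed.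

Lemma csqsD g F G : csqs g F -> csqs g G -> csqs g (fun xi => F xi + G xi).
Proof.
move=> [sr si] [tr ti]; split.
  by rewrite (_ : _ \o _ = fun xi => (Re \o F) xi + (Re \o G) xi);
    [exact: sqsD|apply/funext => xi /=; exact: cReD].
by rewrite (_ : _ \o _ = fun xi => (Im \o F) xi + (Im \o G) xi);
  [exact: sqsD|apply/funext => xi /=; exact: cImD].
Qed.

Lemma csqs_conj g F : csqs g F -> csqs g (fun xi => conjc (F (- xi))).
Proof.
move=> [sr si]; split.
  by rewrite (_ : _ \o _ = fun xi => (Re \o F) (- xi));
    [exact: sqs_oppx|apply/funext => xi /=; exact: cReJ].
by rewrite (_ : _ \o _ = fun xi => - (Im \o F) (- xi));
  [exact/sqsN/sqs_oppx|apply/funext => xi /=; exact: cImJ].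
Qed.

Lemma eq_cint F G : (forall xi, F xi = G xi) -> cint F = cint G.
Proof. by move=> FG; congr cint; apply/funext. Qed.

Lemma cintD g F G : csqs g F -> csqs g G ->
  cint (fun xi => F xi + G xi) = cint F + cint G.
Proof.
move=> [sr si] [tr ti]; apply: complex_ext => /=.
  under eq_Rintegral do rewrite cReD.
  by apply: RintegralD => //; [exact: sqs_integrable sr|exact: sqs_integrable tr].
under eq_Rintegral do rewrite cImD.
by apply: RintegralD => //; [exact: sqs_integrable si|exact: sqs_integrable ti].
Qed.

(** The integrand of a convolution is a product of two square-integrable functions: integrable, but
    possibly not square integrable, so [csqs] is too strong for it. *)
Definition cintegrable F := mu.-integrable setT (EFin \o (Re \o F)) /\
  mu.-integrable setT (EFin \o (Im \o F)).

Lemma csqs_cintegrable g F : csqs g F -> cintegrable F.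
Proof. by move=> [/sqs_integrable ? /sqs_integrable]. Qed.

Lemma cintZ F z : cintegrable F -> cint (fun xi => z * F xi) = z * cint F.
Proof.
move=> [ir ii]; apply: complex_ext.
  rewrite cReM /=; under eq_Rintegral do rewrite cReM.
  rewrite RintegralB//; [|exact: integrable_scaleR..].
  by rewrite !RintegralZl.
rewrite cImM /=; under eq_Rintegral do rewrite cImM.
rewrite RintegralD//; [|exact: integrable_scaleR..].
by rewrite !RintegralZl.
Qed.

Lemma cint_conj g F : csqs g F -> cint (fun xi => conjc (F (- xi))) = conjc (cint F).
Proof.
move=> [/sqs_integrable ir /sqs_integrable ii]; apply: complex_ext.
  rewrite cReJ /= -(Rintegral_refl 0 ir).
  by apply: eq_Rintegral => xi _; rewrite cReJ sub0r.
rewrite cImJ /= -(Rintegral_refl 0 ii) -mulN1r -RintegralZl//; last first.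
  exact: (integrable_refl 0 ii).
by apply: eq_Rintegral => xi _; rewrite cImJ sub0r mulN1r.
Qed.

(** * Convolution of complex symbols *)

Definition cconv P Q s : C := cint (fun x => P x * Q (s - x)).

Let Re_cconv g d P Q : csqs g P -> csqs d Q -> Re \o cconv P Q =
  fun s => convol (Re \o P) (Re \o Q) s - convol (Im \o P) (Im \o Q) s.
Proof.
move=> [[pr _] [pi _]] [[qr _] [qi _]]; apply/funext => s /=.
under eq_Rintegral do rewrite cReM.
by rewrite RintegralB//; [exact: (conv_integrable s pr qr)|
  exact: (conv_integrable s pi qi)].
Qed.

Let Im_cconv g d P Q : csqs g P -> csqs d Q -> Im \o cconv P Q =
  fun s => convol (Re \o P) (Im \o Q) s + convol (Im \o P) (Re \o Q) s.
Proof.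
move=> [[pr _] [pi _]] [[qr _] [qi _]]; apply/funext => s /=.
under eq_Rintegral do rewrite cImM.
by rewrite RintegralD//; [exact: (conv_integrable s pr qi)|
  exact: (conv_integrable s pi qr)].
Qed.

Lemma cconv_cintegrable g d P Q s : csqs g P -> csqs d Q ->
  cintegrable (fun x => P x * Q (s - x)).
Proof.
move=> [[pr _] [pi _]] [[qr _] [qi _]]; split.
  have := integrable_addR (conv_integrable s pr qr)
    (integrable_oppR (conv_integrable s pi qi)).
  by congr (mu.-integrable _ _); apply/funext => x /=; rewrite cReM.
have := integrable_addR (conv_integrable s pr qi) (conv_integrable s pi qr).
by congr (mu.-integrable _ _); apply/funext => x /=; rewrite cImM.
Qed.

Lemma csqs_cconv g d P Q : csqs g P -> csqs d Q -> csqs (g + d) (cconv P Q).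
Proof.
move=> sP sQ; have [[pr pi] [qr qi]] := (sP, sQ); split.
  by rewrite (Re_cconv sP sQ); apply: sqsB; exact: sqs_conv.
by rewrite (Im_cconv sP sQ); apply: sqsD; exact: sqs_conv.
Qed.

(** [PWM] applies this to symbols multiplied by [ek z], where it becomes the convolution theorem at
    the point z. *)
Lemma cint_cconv g d P Q : csqs g P -> csqs d Q ->
  cint (cconv P Q) = cint P * cint Q.
Proof.
move=> sP sQ; have [[pr pi] [qr qi]] := (sP, sQ); apply: complex_ext.
  rewrite cReM /cint; transitivity (Rintegral mu setT (Re \o cconv P Q)) => //.
  rewrite (Re_cconv sP sQ) RintegralB//.
  - by rewrite (Rintegral_conv pr qr) (Rintegral_conv pi qi).
  - exact: sqs_integrable (sqs_conv pr qr).
  - exact: sqs_integrable (sqs_conv pi qi).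
rewrite cImM /cint; transitivity (Rintegral mu setT (Im \o cconv P Q)) => //.
rewrite (Im_cconv sP sQ) RintegralD//.
- by rewrite (Rintegral_conv pr qi) (Rintegral_conv pi qr).
- exact: sqs_integrable (sqs_conv pr qi).
- exact: sqs_integrable (sqs_conv pi qr).
Qed.

Let kC : C := (2 * pi)^-1%:C%C.

(* The symbol is extended by zero outside [[-g, g]], so that integrals can be
   taken over the whole line. *)
Lemma PWP g f : PW g f <-> exists F, csqs g F /\
  forall z, f z = kC * cint (fun xi => F xi * ek z xi).
Proof.
have inI x : (x \in `[- g, g]%classic) = (`|x| <= g).
  by rewrite ler_norml; apply/idP/idP; rewrite inE/= in_itv.
have restrE F G : (forall x, `|x| <= g -> F x = G x) ->
    (forall x, g < `|x| -> G x = 0) -> cintegral (- g) g F = cint G.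
  move=> FG G0; rewrite /cintegral /cint [LHS](_ : _ =
    ((\int[mu]_(x in `[- g, g]) Re (F x))%R +i*
     (\int[mu]_(x in `[- g, g]) Im (F x))%R)%C); last by simpc.
  congr Complex; rewrite Rintegral_mkcond; apply: eq_Rintegral => x _;
    rewrite /patch inI; (case: leP => xg; [by rewrite FG|by rewrite G0]).
split=> [[F [[mr [mi ifin]] fE]]|[F [[[[mr ir] r0] [[mi ii] i0]] fE]]].
  pose F0 x : C := if `|x| <= g then F x else 0.
  have F00 x : g < `|x| -> F0 x = 0 by rewrite /F0 leNgt => ->.
  have mI : measurable (`[- g, g] : set R) by [].
  have rE : Re \o F0 = (Re \o F) \_ `[- g, g].
    by apply/funext => x; rewrite /F0 /patch/= inI; case: leP.
  have iE : Im \o F0 = (Im \o F) \_ `[- g, g].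
    by apply/funext => x; rewrite /F0 /patch/= inI; case: leP.
  have mr0 : measurable_fun setT (Re \o F0).
    by rewrite rE; exact: (measurable_restrictT (Re \o F) mI).1 mr.
  have mi0 : measurable_fun setT (Im \o F0).
    by rewrite iE; exact: (measurable_restrictT (Im \o F) mI).1 mi.
  have i2 : mu.-integrable setT (EFin \o (fun x => cmod (F0 x) ^+ 2)).
    apply/integrableP; split.
      apply/measurable_EFinP; under eq_fun do rewrite cmod2E.
      by apply: measurable_funD; exact: measurable_funX.
    move: ifin; rewrite integral_mkcond; congr (_ < _)%E.
    apply: eq_integral => x _; rewrite /patch inI /= /F0.
    have c0 : cmod (0 : C) ^+ 2 = 0 by rewrite cmod2E; simpl; ring.
    by case: leP => _; rewrite ?c0 ?normr0// ger0_norm ?sqr_ge0.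
  have le2 z : Re z ^+ 2 <= cmod z ^+ 2 /\ Im z ^+ 2 <= cmod z ^+ 2.
    by rewrite cmod2E; split; rewrite ?lerDl ?lerDr sqr_ge0.
  exists F0; split; first split; last first.
  - move=> z; rewrite fE; congr (_ * _); apply: restrE => x xg.
      by rewrite /F0 xg.
    by rewrite F00// mul0r.
  - split; last by move=> x gx /=; rewrite F00.
    split=> //; apply: integrable_le i2 _; first exact: measurable_funX.
    by move=> x; rewrite ger0_norm ?sqr_ge0//; case: (le2 (F0 x)).
  - split; last by move=> x gx /=; rewrite F00.
    split=> //; apply: integrable_le i2 _; first exact: measurable_funX.
    by move=> x; rewrite ger0_norm ?sqr_ge0//; case: (le2 (F0 x)).
have F0 x : g < `|x| -> F x = 0.
  by move=> gx; apply: complex_ext; [exact: r0|exact: i0].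
exists F; split.
  split; first exact: measurable_funTS mr.
  split; first exact: measurable_funTS mi.
  under eq_integral do rewrite cmod2E.
  have : mu.-integrable `[- g, g] (EFin \o
      (fun x => (Re \o F) x ^+ 2 + (Im \o F) x ^+ 2)).
    by apply: integrableS (integrable_addR ir ii).
  move=> /integrableP[_]; apply: le_lt_trans; rewrite le_eqVlt; apply/orP; left; apply/eqP.
  by apply: eq_integral => x _ /=; rewrite ger0_norm// addr_ge0 ?sqr_ge0.
move=> z; rewrite fE; congr (_ * _); apply/esym/restrE => // x gx.
by rewrite F0// mul0r.
Qed.

(** * Closure properties of Paley-Wiener spaces *)

Lemma PWD g f h : PW g f -> PW g h -> PW g (fun z => f z + h z).
Proof.
move=> /PWP[F [sF fE]] /PWP[G [sG hE]]; apply/PWP.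
exists (fun xi => F xi + G xi); split; first exact: csqsD.
move=> z; rewrite fE hE -mulrDr; congr (_ * _).
rewrite -(cintD (csqs_ek z sF) (csqs_ek z sG)).
by apply: eq_cint => xi; rewrite mulrDl.
Qed.

Lemma PWZ g f w : PW g f -> PW g (fun z => w * f z).
Proof.
move=> /PWP[F [sF fE]]; apply/PWP; exists (fun xi => w * F xi).
split; first exact: csqsZ.
move=> z; rewrite fE mulrCA; congr (_ * _).
rewrite -(cintZ w (csqs_cintegrable (csqs_ek z sF))).
by apply: eq_cint => xi; rewrite mulrA.
Qed.

Lemma PWB g f h : PW g f -> PW g h -> PW g (fun z => f z - h z).
Proof.
move=> Pf /(PWZ (-1)) Ph; have := PWD Pf Ph.
by under eq_fun do rewrite mulN1r.
Qed.

(** Conjugating e^{i conj(z) xi} gives e^{-i z xi}; after the substitution xi -> -xi the symbol is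
    conj F(-xi), again supported in [-g, g]. *)
Lemma PW_sharp g f : PW g f -> PW g (fsharp f).
Proof.
move=> /PWP[F [sF fE]]; apply/PWP; exists (fun xi => conjc (F (- xi))).
split; first exact: csqs_conj.
move=> z; rewrite /fsharp fE rmorphM; congr (_ * _); first exact: conjc_real.
apply: etrans (esym (cint_conj (csqs_ek (conjc z) sF))) _.
apply: eq_cint => xi.
have := ek_conj z (- xi); rewrite opprK => <-; exact: rmorphM.
Qed.

Lemma PWM g d f h : PW g f -> PW d h -> PW (g + d) (fun z => f z * h z).
Proof.
move=> /PWP[F [sF fE]] /PWP[G [sG hE]]; apply/PWP.
(* The product carries two factors 1/(2 pi): one stays in front of the integral, the other is
   absorbed into the symbol. *)
exists (fun s => kC * cconv F G s); split; first exact/csqsZ/csqs_cconv.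
move=> z; rewrite fE hE mulrACA -(cint_cconv (csqs_ek z sF) (csqs_ek z sG)).
rewrite -mulrA.
rewrite -(cintZ kC (csqs_cintegrable (csqs_cconv (csqs_ek z sF) (csqs_ek z sG)))).
congr (_ * _); apply: eq_cint => s; rewrite -mulrA; congr (_ * _).
rewrite mulrC -(cintZ _ (cconv_cintegrable s sF sG)); apply: eq_cint => x.
(* The kernel is multiplicative in the frequency, so it distributes over the two factors of the
   convolution. *)
have -> : ek z s = ek z x * ek z (s - x) by rewrite -ek_add addrC subrK.
ring.
Qed.

Lemma Re_ek_real x xi : Re (ek x%:C%C xi) = cos (x * xi).
Proof. by rewrite Re_ek/= oppr0 mul0r expR0 mul1r. Qed.

Lemma Im_ek_real x xi : Im (ek x%:C%C xi) = sin (x * xi).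
Proof. by rewrite Im_ek/= oppr0 mul0r expR0 mul1r. Qed.

Lemma is_derive_cint g F x : csqs g F ->
  is_derive x 1 (fun x => Re (cint (fun xi => F xi * ek x%:C%C xi)))
    (Re (cint (fun xi => 'i%C * (F xi * xi%:C%C) * ek x%:C%C xi))) /\
  is_derive x 1 (fun x => Im (cint (fun xi => F xi * ek x%:C%C xi)))
    (Im (cint (fun xi => 'i%C * (F xi * xi%:C%C) * ek x%:C%C xi))).
Proof.
move=> [sr si].
have csn (u : R) : is_derive u 1 cos (- sin u) by exact: is_derive_cos.
have sns (u : R) : is_derive u 1 sin (cos u) by exact: is_derive_sin.
have sin1 (u : R) : `|sin u| <= 1 by rewrite ler_norml sin_geN1 sin_le1.
have nsin1 (u : R) : `|- sin u| <= 1 by rewrite normrN.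
have cos1 (u : R) : `|cos u| <= 1 by rewrite ler_norml cos_geN1 cos_le1.
have cc y : continuous (fun xi => cos (y * xi)).
  by apply: continuous_scale => u; exact: continuous_cos.
have cs y : continuous (fun xi => sin (y * xi)).
  by apply: continuous_scale => u; exact: continuous_sin.
have cns y : continuous (fun xi => - sin (y * xi)).
  by move=> u; apply: cvgN; exact: cs.
have ci : continuous (fun xi : R => xi) by move=> u; exact: cvg_id.
split.
- rewrite [X in is_derive _ _ X](_ : _ = (fun x =>
      \int[mu]_xi ((Re \o F) xi * cos (x * xi)) -
      \int[mu]_xi ((Im \o F) xi * sin (x * xi)))%R); last first.
    apply/funext => y; rewrite -RintegralB//; last 2 first.
    - exact: sqs_integrableM sr (cc y).
    - exact: sqs_integrableM si (cs y).
    by apply: eq_Rintegral => xi _; rewrite cReM Re_ek_real Im_ek_real.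
  have := is_deriveB (is_derive_Rintegral_scale x sr csn nsin1)
    (is_derive_Rintegral_scale x si sns cos1).
  move/is_derive_eq; apply; rewrite -RintegralB//; last 2 first.
  - exact: sqs_integrableM (sqsM sr ci) (cns x).
  - exact: sqs_integrableM (sqsM si ci) (cc x).
  apply: eq_Rintegral => xi _; rewrite cReM Re_ek_real Im_ek_real !cReM !cImM ?cReM/=.
  ring.
- rewrite [X in is_derive _ _ X](_ : _ = (fun x =>
      \int[mu]_xi ((Re \o F) xi * sin (x * xi)) +
      \int[mu]_xi ((Im \o F) xi * cos (x * xi)))%R); last first.
    apply/funext => y; rewrite -RintegralD//; last 2 first.
    - exact: sqs_integrableM sr (cs y).
    - exact: sqs_integrableM si (cc y).
    by apply: eq_Rintegral => xi _; rewrite cImM Re_ek_real Im_ek_real.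
  have := is_deriveD (is_derive_Rintegral_scale x sr sns cos1)
    (is_derive_Rintegral_scale x si csn nsin1).
  move/is_derive_eq; apply; rewrite -RintegralD//; last 2 first.
  - exact: sqs_integrableM (sqsM sr ci) (cc x).
  - exact: sqs_integrableM (sqsM si ci) (cns x).
  apply: eq_Rintegral => xi _; rewrite cImM Re_ek_real Im_ek_real !cReM !cImM ?cReM/=.
  ring.
Qed.

(** The derivative has symbol i xi F(xi), which stays square integrable because xi is bounded on the
    support. *)
Lemma PW_derive g f : PW g f -> exists f', PW g f' /\ forall x,
  is_derive x 1 (fun x => Re (f x%:C%C)) (Re (f' x%:C%C)) /\
  is_derive x 1 (fun x => Im (f x%:C%C)) (Im (f' x%:C%C)).
Proof.
move=> /PWP[F [sF fE]].
have sF' : csqs g (fun xi => 'i%C * (F xi * xi%:C%C)) by exact/csqsZ/csqs_id.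
exists (fun z => kC * cint (fun xi => 'i%C * (F xi * xi%:C%C) * ek z xi)).
split; first by apply/PWP; exists (fun xi => 'i%C * (F xi * xi%:C%C)).
move=> x; have [dr di] := is_derive_cint x sF.
have ReZ z : Re (kC * z) = (2 * pi)^-1 * Re z by rewrite cReM /= mul0r subr0.
have ImZ z : Im (kC * z) = (2 * pi)^-1 * Im z by rewrite cImM /= mul0r addr0.
split.
  rewrite ReZ; under eq_fun do rewrite fE ReZ.
  exact: is_deriveZ dr.
rewrite ImZ; under eq_fun do rewrite fE ImZ.
exact: is_deriveZ di.
Qed.

End PaleyWiener.

(** * Identity theorem and sampling *)

Section Uniqueness.
Context {R : realType}.
Local Notation mu := (@lebesgue_measure R).
Local Notation C := (R[i]).
Local Notation Re := (@complex.Re R).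
Local Notation Im := (@complex.Im R).
Implicit Types (g d x y xi : R) (F G : R -> C) (z w : C) (f h : C -> C).

Lemma is_derive_near0 (u : R -> R) x (l : R) :
  (\forall y \near x, u y = 0) -> is_derive x 1 u l -> l = 0.
Proof.
move=> u0 du; have [_ <-] := near_eq_is_derive (g := cst 0) u0 du.
exact: derive_cst.
Qed.

(** Each derivative in x brings down a factor i xi; iteration reaches every moment. *)
Lemma cint_ek_near0 g F x0 : csqs g F ->
  (\forall x \near x0, cint (fun xi => F xi * ek x%:C%C xi) = 0) ->
  \forall x \near x0, cint (fun xi => F xi * xi%:C%C * ek x%:C%C xi) = 0.
Proof.
(* The integral vanishes on a neighbourhood of every x close to x0, so its derivative vanishes at x
   and not only at x0. *)
move=> sF /nbhs_interior; apply: filterS => x F0.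
have [dr di] := is_derive_cint x sF.
have iF : cint (fun xi => 'i%C * (F xi * xi%:C%C) * ek x%:C%C xi) = 0.
  apply: complex_ext.
    by apply: is_derive_near0 dr; apply: filterS F0 => y /(congr1 Re).
  by apply: is_derive_near0 di; apply: filterS F0 => y /(congr1 Im).
have := csqs_cintegrable (csqs_ek x%:C%C (csqs_id sF)) => /(cintZ 'i%C).
under eq_cint do rewrite mulrA.
rewrite iF => /esym/eqP; rewrite mulf_eq0 => /orP[|/eqP//].
by rewrite eq_complex/= oner_eq0 andbF.
Qed.

Lemma PW_near0 g f x0 : PW g f -> (\forall x \near x0, f x%:C%C = 0) ->
  forall z, f z = 0.
Proof.
move=> /PWP[F [sF fE]] f0 z.
have k0 : ((2 * pi)^-1 : R)%:C%C != 0.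
  by rewrite eq_complex/= eqxx andbT invr_neq0// mulf_neq0// gt_eqF// pi_gt0.
have {}f0 : \forall x \near x0, cint (fun xi => F xi * ek x%:C%C xi) = 0.
  apply: filterS f0 => x; rewrite fE => /eqP.
  by rewrite mulf_eq0 (negbTE k0)/= => /eqP.
(* The induction keeps vanishing near x0, not just at x0, so that the next derivative can be
   taken. *)
have mom n : csqs g (fun xi => F xi * (xi%:C%C) ^+ n) /\
    \forall x \near x0, cint (fun xi => F xi * (xi%:C%C) ^+ n * ek x%:C%C xi) = 0.
  elim: n => [|n [sn IH]].
    split; first by under eq_fun do rewrite expr0 mulr1.
    by apply: filterS f0 => x <-; apply: eq_cint => xi; rewrite expr0 mulr1.
  have [sn1 IH1] := (csqs_id sn, cint_ek_near0 sn IH); split.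
    by under eq_fun do rewrite exprSr mulrA.
  by apply: filterS IH1 => x <-; apply: eq_cint => xi; rewrite exprSr mulrA.
pose H xi := F xi * ek x0%:C%C xi.
have sH : csqs g H by exact: csqs_ek.
have XE xi n : xi%:C%C ^+ n = (xi ^+ n)%:C%C by rewrite rmorphXn.
have ReX (w : C) xi n : Re (w * xi%:C%C ^+ n) = Re w * xi ^+ n.
  by rewrite XE cReM /= mulr0 subr0.
have ImX (w : C) xi n : Im (w * xi%:C%C ^+ n) = Im w * xi ^+ n.
  by rewrite XE cImM /= mulr0 add0r.
have momH n : cint (fun xi => H xi * (xi%:C%C) ^+ n) = 0.
  have [_ /nbhs_singleton <-] := mom n.
  by apply: eq_cint => xi; rewrite /H mulrAC.
have momr n : (\int[mu]_xi ((Re \o H) xi * xi ^+ n) = 0)%R.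
  transitivity (Re (cint (fun xi => H xi * (xi%:C%C) ^+ n))); last by rewrite momH.
  by apply: eq_Rintegral => xi _; rewrite ReX.
have momi n : (\int[mu]_xi ((Im \o H) xi * xi ^+ n) = 0)%R.
  transitivity (Im (cint (fun xi => H xi * (xi%:C%C) ^+ n))); last by rewrite momH.
  by apply: eq_Rintegral => xi _; rewrite ImX.
have cX n : continuous (fun xi : R => xi ^+ n) by move=> v; exact: exprn_continuous.
have cexp y : continuous (fun xi => expR (y * xi)).
  by apply: continuous_scale => v; exact: continuous_expR.
(* The kernel at w is e^{-Im(w) xi} (cos(Re(w) xi) + i sin(Re(w) xi)). The real exponential is
   absorbed into the weight first: each a(xi) xi^n also has vanishing moments, so the new weight
   does too. Cosine and sine are then expanded against that weight. *)
have momE a y : sqs g a -> (forall n, \int[mu]_xi (a xi * xi ^+ n) = 0)%R ->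
    forall n, (\int[mu]_xi (a xi * expR (y * xi) * xi ^+ n) = 0)%R.
  move=> sa am n; under eq_Rintegral do rewrite mulrAC.
  apply: (moments_expR y (sqsM sa (cX n))) => m.
  by under eq_Rintegral do rewrite -mulrA -exprD; exact: am.
pose w := z - x0%:C%C.
have zE xi : F xi * ek z xi = H xi * ek w xi.
  by rewrite /H -mulrA -ekD /w addrC subrK.
rewrite fE (eq_cint zE) (_ : cint _ = 0) ?mulr0//.
have [sr si] := sH.
have mr := momE _ (- Im w) sr momr; have mi := momE _ (- Im w) si momi.
have sr' := sqsM sr (cexp (- Im w)); have si' := sqsM si (cexp (- Im w)).
have cc y : continuous (fun xi => cos (y * xi)).
  by apply: continuous_scale => u; exact: continuous_cos.
have cs y : continuous (fun xi => sin (y * xi)).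
  by apply: continuous_scale => u; exact: continuous_sin.
apply: complex_ext => /=.
  under eq_Rintegral do rewrite cReM Re_ek Im_ek !mulrA.
  rewrite RintegralB//; [|exact: (sqs_integrableM sr')|exact: (sqs_integrableM si')].
  by rewrite (moments_cos _ sr' mr) (moments_sin _ si' mi) subrr.
under eq_Rintegral do rewrite cImM Re_ek Im_ek !mulrA.
rewrite RintegralD//; [|exact: (sqs_integrableM sr')|exact: (sqs_integrableM si')].
by rewrite (moments_sin _ sr' mr) (moments_cos _ si' mi) addr0.
Qed.

Lemma PW_real0 g f : PW g f -> (forall x, f x%:C%C = 0) -> forall z, f z = 0.
Proof.
move=> Pf f0; apply: (PW_near0 (x0 := 0) Pf).
by near=> x; exact: f0.
Unshelve. all: by end_near. Qed.

Lemma PW_continuous g f : PW g f ->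
  continuous (fun x => Re (f x%:C%C)) /\ continuous (fun x => Im (f x%:C%C)).
Proof.
move=> /PW_derive[f' [_ df]]; split=> x; have [dr di] := df x.
  by apply/differentiable_continuous/derivable1_diffP; case: dr.
by apply/differentiable_continuous/derivable1_diffP; case: di.
Qed.

Lemma PW_cmod2_continuous g f : PW g f -> continuous (fun x => cmod (f x%:C%C) ^+ 2).
Proof.
move=> /PW_continuous[cr ci] x; under eq_fun do rewrite cmod2E.
by apply: cvgD; [under eq_fun do rewrite expr2; apply: cvgM; exact: cr|
  under eq_fun do rewrite expr2; apply: cvgM; exact: ci].
Qed.

Lemma cmod2_eq0 z : (cmod z ^+ 2 == 0) = (z == 0).
Proof.
by rewrite cmod2E paddr_eq0 ?sqr_ge0// !sqrf_eq0 eq_complex.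
Qed.

Lemma PW_neq0_near g f x0 : PW g f -> f x0%:C%C != 0 ->
  \forall x \near x0, f x%:C%C != 0.
Proof.
move=> Pf; rewrite -cmod2_eq0 => f0.
have f0' : 0 < cmod (f x0%:C%C) ^+ 2 by rewrite lt0r f0 sqr_ge0.
have near0 : \forall x \near x0, 0 < cmod (f x%:C%C) ^+ 2.
  exact: cvgr_gt (@PW_cmod2_continuous _ _ Pf x0) _ f0'.
by apply: filterS near0 => x /lt0r_neq0; rewrite cmod2_eq0.
Qed.

(** Where f is nonzero at a real point it is nonzero nearby, so h vanishes nearby and the identity
    theorem applies to h. *)
Lemma PW_mul_eq0 g f h : PW g f -> PW g h ->
  (forall x, f x%:C%C * h x%:C%C = 0) ->
  (forall x, f x%:C%C = 0) \/ (forall x, h x%:C%C = 0).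
Proof.
move=> Pf Ph fh0; have [f0|/existsNP[x0 /eqP f0]] := pselect (forall x, f x%:C%C = 0).
  by left.
right=> x; apply: (PW_near0 (x0 := x0) Ph).
apply: filterS (PW_neq0_near Pf f0) => y fy.
by have /eqP := fh0 y; rewrite mulf_eq0 (negbTE fy) => /eqP.
Qed.

Lemma continuous_integral_eq0 (u : R -> R) : continuous u -> (forall x, 0 <= u x) ->
  (\int[mu]_x (u x)%:E = 0)%E -> forall x, u x = 0.
Proof.
move=> cu u0 iu x; apply/eqP; rewrite eq_le u0 andbT leNgt; apply/negP => ux.
have mu_ : measurable_fun setT (EFin \o u).
  by apply/measurable_EFinP; exact: continuous_measurable_fun.
have ux2 : u x / 2 < u x by lra.
have near2 : \forall y \near x, u x / 2 < u y by exact: cvgr_gt (cu x) _ ux2.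
have /nbhs_ballP[e /= e0 xe] := near2.
(* On the interval of radius e around x the function exceeds u(x)/2, so its integral is at least
   u(x)/2 times the length 2e, which is positive. *)
have : ((u x / 2 * (2 * e))%:E <= \int[mu]_x (u x)%:E)%E.
  apply: (@le_trans _ _ (\int[mu]_(y in `](x - e)%R, (x + e)%R[) (u y)%:E)%E); last first.
    by apply: ge0_subset_integral => //= y _; rewrite lee_fin.
  apply: (@le_trans _ _ (\int[mu]_(y in `](x - e)%R, (x + e)%R[) (u x / 2)%:E)%E).
    rewrite integral_cst//= lebesgue_measure_itv/= lte_fin.
    rewrite ifT; last by lra.
    by rewrite -EFinB -EFinM lee_fin ler_wpM2l//; lra.
  apply: ge0_le_integral => //=.
  - by move=> y _; rewrite lee_fin; lra.
  - exact: measurable_funTS.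
  - move=> y; rewrite in_itv/= => /andP[xy yx]; rewrite lee_fin.
    apply/ltW/xe; rewrite /ball/= ltr_norml; apply/andP; split; lra.
by rewrite iu lee_fin leNgt; apply/negP; rewrite negbK; apply: mulr_gt0; lra.
Qed.

(** The lower sampling inequality forces the L^2 norm to be 0, and continuity turns this into
    vanishing at every real point. *)
Lemma sampling_eq0 g (t : int -> R) f : sampling_set g t -> PW g f ->
  (forall n, f (t n)%:C%C = 0) -> forall x, f x%:C%C = 0.
Proof.
move=> [A [B [A0 [_ samp]]]] Pf ft0 x.
have [+ _] := samp _ Pf.
rewrite esum1; last first.
  by move=> n _; rewrite ft0 cmod2E /= expr0n addr0.
have L0 : (0 <= L2norm2 f)%E by apply: integral_ge0 => y _; rewrite lee_fin sqr_ge0.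
rewrite pmule_rle0 ?lte_fin// => L0'.
have {L0'}L0 : L2norm2 f = 0%E by apply/eqP; rewrite eq_le L0'.
have := continuous_integral_eq0 (PW_cmod2_continuous Pf) (fun y => sqr_ge0 _) L0 x.
by move/eqP; rewrite cmod2_eq0 => /eqP.
Qed.

End Uniqueness.

(** * Phase retrieval *)

Section PhaseRetrieval.
Context {R : realType}.
Local Notation C := (R[i]).
Local Notation Re := (@complex.Re R).
Local Notation Im := (@complex.Im R).
Implicit Types (x y : R) (z w : C) (f g : C -> C).

Lemma is_derive0_near_cst (u : R -> R) x0 :
  (\forall x \near x0, is_derive (x : R) 1 u 0) -> \forall x \near x0, u x = u x0.
Proof.
move=> /nbhs_ballP[e /= e0 du].
have itvS x y (z : R) : ball x0 e x -> ball x0 e y -> z \in `[x, y] -> ball x0 e z.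
  rewrite /ball/= !ltr_norml in_itv/= => /andP[? ?] /andP[? ?] /andP[? ?].
  by apply/andP; split; lra.
have cst x y : ball x0 e x -> ball x0 e y -> x <= y -> u x = u y.
  move=> bx by_ xy.
  have [] := @MVT_segment R u (fun=> 0) x y xy.
  - by move=> z zxy; apply/du/(itvS x y) => //; exact: subset_itv_oo_cc.
  - apply: derivable_within_continuous => z zxy.
    by case: (du z (itvS x y z bx by_ zxy)).
  - by move=> z _; rewrite mul0r => /eqP; rewrite subr_eq0 => /eqP.
apply/nbhs_ballP; exists e => //= x bx.
have bx0 : ball x0 e x0 by exact: ballxx.
by have [xx0|/ltW x0x] := leP x x0; [exact: cst|rewrite (cst x0 x)].
Qed.

(* Here f = a + ib and g = c + id; the hypotheses say |f| = |g| and
   f' conj(f) = g' conj(g), and p + iq is the value at [x0] of f/g. *)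
Lemma proportional_near (a b c d a' b' c' d' : R -> R) x0 :
  (forall x, is_derive x 1 a (a' x)) -> (forall x, is_derive x 1 b (b' x)) ->
  (forall x, is_derive x 1 c (c' x)) -> (forall x, is_derive x 1 d (d' x)) ->
  (forall x, a x ^+ 2 + b x ^+ 2 = c x ^+ 2 + d x ^+ 2) ->
  (forall x, a x * a' x + b x * b' x = c x * c' x + d x * d' x) ->
  (forall x, a x * b' x - b x * a' x = c x * d' x - d x * c' x) ->
  (\forall x \near x0, c x ^+ 2 + d x ^+ 2 != 0) ->
  exists p q, \forall x \near x0, a x = p * c x - q * d x /\ b x = p * d x + q * c x.
Proof.
move=> da db dc dd N s k N0.
(* [P] and [Q] are the real and imaginary parts of f conj(g) / |g|^2 = f/g. *)
pose P x := (a x * c x + b x * d x) * (c x ^+ 2 + d x ^+ 2)^-1.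
pose Q x := (b x * c x - a x * d x) * (c x ^+ 2 + d x ^+ 2)^-1.
have dN x : is_derive x 1 (fun x => c x ^+ 2 + d x ^+ 2)
    (2 * (c x * c' x + d x * d' x)).
  have := is_deriveD (is_deriveX 2 (dc x)) (is_deriveX 2 (dd x)).
  by move/is_derive_eq; apply; rewrite /GRing.scale/= !expr1; ring.
(* With u = s + ik this is n f' = u f and n g' = u g. *)
have rel x : let n := c x ^+ 2 + d x ^+ 2 in
    let s := c x * c' x + d x * d' x in let k := c x * d' x - d x * c' x in
    [/\ n * a' x = s * a x - k * b x, n * b' x = s * b x + k * a x,
        n * c' x = s * c x - k * d x & n * d' x = s * d x + k * c x].
  rewrite /=; split; try ring.
    by rewrite -(N x) -(s x) -(k x); ring.
  by rewrite -(N x) -(s x) -(k x); ring.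
have dP x : c x ^+ 2 + d x ^+ 2 != 0 -> is_derive x 1 P 0.
  move=> nx; have := is_deriveM
    (is_deriveD (is_deriveM (da x) (dc x)) (is_deriveM (db x) (dd x)))
    (is_deriveV (f := fun x => c x ^+ 2 + d x ^+ 2) nx (dN x)).
  move/is_derive_eq; apply; rewrite !fctE /GRing.scale/=.
  (* Multiplication by n^2, with n = |g|^2, clears the denominators; the terms are then grouped so
     that each derivative appears with a factor n and [rel] can eliminate it. *)
  apply: (mulIf (mulf_neq0 nx nx)); rewrite mul0r.
  have [ra rb rc rd] := rel x.
  rewrite [LHS](_ : _ = (a x * (
      (c x ^+ 2 + d x ^+ 2) * c' x) + c x * ((c x ^+ 2 + d x ^+ 2) * a' x) +
      b x * ((c x ^+ 2 + d x ^+ 2) * d' x) + d x * ((c x ^+ 2 + d x ^+ 2) * b' x))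
      - 2 * (a x * c x + b x * d x) * (c x * c' x + d x * d' x)); last by field.
  by rewrite ra rb rc rd; ring.
have dQ x : c x ^+ 2 + d x ^+ 2 != 0 -> is_derive x 1 Q 0.
  move=> nx; have := is_deriveM
    (is_deriveB (is_deriveM (db x) (dc x)) (is_deriveM (da x) (dd x)))
    (is_deriveV (f := fun x => c x ^+ 2 + d x ^+ 2) nx (dN x)).
  move/is_derive_eq; apply; rewrite !fctE /GRing.scale/=.
  apply: (mulIf (mulf_neq0 nx nx)); rewrite mul0r.
  have [ra rb rc rd] := rel x.
  rewrite [LHS](_ : _ = (b x * (
      (c x ^+ 2 + d x ^+ 2) * c' x) + c x * ((c x ^+ 2 + d x ^+ 2) * b' x) -
      a x * ((c x ^+ 2 + d x ^+ 2) * d' x) - d x * ((c x ^+ 2 + d x ^+ 2) * a' x))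
      - 2 * (b x * c x - a x * d x) * (c x * c' x + d x * d' x)); last by field.
  by rewrite ra rb rc rd; ring.
exists (P x0), (Q x0).
have cP := is_derive0_near_cst (filterS dP N0).
have cQ := is_derive0_near_cst (filterS dQ N0).
near=> x.
have nx : c x ^+ 2 + d x ^+ 2 != 0 by near: x.
have <- : P x = P x0 by near: x; exact: cP.
have <- : Q x = Q x0 by near: x; exact: cQ.
by rewrite /P /Q; split; field.
Unshelve. all: by end_near. Qed.

Lemma cmodM z w : cmod (z * w) = cmod z * cmod w.
Proof.
rewrite /cmod -sqrtrM ?addr_ge0 ?sqr_ge0// cReM cImM; congr Num.sqrt; ring.
Qed.

(** The derivative is carried as a second element of the space, so that [fsharp], products and
    sampling apply to it as well. *)
Definition PW_deriv_pair gam f f' := [/\ PW gam f, PW gam f',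
  (forall x, is_derive x 1 (fun x => Re (f x%:C%C)) (Re (f' x%:C%C))) &
  (forall x, is_derive x 1 (fun x => Im (f x%:C%C)) (Im (f' x%:C%C)))].

(** On the real line f'/f = f' conj(f) / |f|^2 wherever f is nonzero, so f and g have the same
    logarithmic derivative there. *)
Lemma PW_proportional gam f f' g g' :
  PW_deriv_pair gam f f' -> PW_deriv_pair gam g g' ->
  (forall x, cmod (f x%:C%C) = cmod (g x%:C%C)) ->
  (forall x, f' x%:C%C * conjc (f x%:C%C) = g' x%:C%C * conjc (g x%:C%C)) ->
  exists lam : C, cmod lam = 1 /\ forall z, f z = lam * g z.
Proof.
move=> [Pf Pf' dfr dfi] [Pg Pg' dgr dgi] fg fg'.
have N x : Re (f x%:C%C) ^+ 2 + Im (f x%:C%C) ^+ 2 =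
    Re (g x%:C%C) ^+ 2 + Im (g x%:C%C) ^+ 2 by rewrite -!cmod2E fg.
have [g0|/existsNP[x0 /eqP g0]] := pselect (forall x, g x%:C%C = 0).
  (* If g vanishes on the real line then so does f, both are zero, and any unimodular factor
     works. *)
  exists 1; split; first by rewrite /cmod/= expr1n expr0n addr0 sqrtr1.
  have f0 x : f x%:C%C = 0 by apply/eqP; rewrite -cmod2_eq0 fg cmod2_eq0 g0.
  by move=> z; rewrite mul1r (PW_real0 Pf f0) (PW_real0 Pg g0).
have [||| p [q pq]] := proportional_near (x0 := x0) dfr dfi dgr dgi N.
- move=> x; have /(congr1 Re) := fg' x.
  by rewrite !cReM !cReJ !cImJ => h; lra.
- move=> x; have /(congr1 Im) := fg' x.
  by rewrite !cImM !cReJ !cImJ => h; lra.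
- apply: filterS (PW_neq0_near Pg g0) => x.
  by rewrite -cmod2_eq0 cmod2E.
pose lam : C := (p +i* q)%C.
have flam x : (Re (f x%:C%C) = p * Re (g x%:C%C) - q * Im (g x%:C%C) /\
    Im (f x%:C%C) = p * Im (g x%:C%C) + q * Re (g x%:C%C)) -> f x%:C%C = lam * g x%:C%C.
  by move=> [fr fi]; apply: complex_ext; rewrite ?cReM ?cImM.
exists lam; split.
  (* Comparing moduli at x0, where |f| = |g| is nonzero, gives |lam| = 1. *)
  have /(congr1 (@cmod R)) := flam x0 (nbhs_singleton pq).
  rewrite cmodM fg => h.
  have n0 : cmod (g x0%:C%C) != 0 by rewrite -sqrf_eq0 cmod2_eq0.
  by apply: (mulIf n0); rewrite mul1r -h.
move=> z; apply/eqP; rewrite -subr_eq0; apply/eqP.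
apply: (PW_near0 (x0 := x0) (PWB Pf (PWZ lam Pg))).
by apply: filterS pq => x /flam ->; rewrite subrr.
Qed.

Lemma PW_deriv_pair_sharp gam f f' : PW_deriv_pair gam f f' ->
  PW_deriv_pair gam (fsharp f) (fsharp f').
Proof.
move=> [Pf Pf' dr di]; split; [exact: PW_sharp|exact: PW_sharp| |] => x.
  rewrite /fsharp conjc_real cReJ.
  by under eq_fun do rewrite conjc_real cReJ.
rewrite /fsharp conjc_real cImJ.
under eq_fun do rewrite conjc_real cImJ.
exact: is_deriveN (di x).
Qed.

Lemma fsharp_real f x : fsharp f x%:C%C = conjc (f x%:C%C).
Proof. by rewrite /fsharp conjc_real. Qed.

Lemma mulcJ_cmod2 z : z * conjc z = (cmod z ^+ 2)%:C%C.
Proof.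
by apply: complex_ext; rewrite cmod2E ?cReM ?cImM cReJ cImJ/=; ring.
Qed.

(** Stated for an arbitrary pair, since it is applied once to the functions and once to their
    derivatives. *)
Lemma sampling_cmod (t : int -> R) gam f g : sampling_set (gam + gam) t ->
  PW gam f -> PW gam g ->
  (forall n, cmod (f (t n)%:C%C) = cmod (g (t n)%:C%C)) ->
  forall x, cmod (f x%:C%C) = cmod (g x%:C%C).
Proof.
move=> samp Pf Pg fg x.
have := sampling_eq0 samp (PWB (PWM Pf (PW_sharp Pf)) (PWM Pg (PW_sharp Pg))).
move=> /(_ _ x) h; have {h} : f x%:C%C * fsharp f x%:C%C - g x%:C%C * fsharp g x%:C%C = 0.
  by apply: h => n; rewrite !fsharp_real !mulcJ_cmod2 fg subrr.
rewrite !fsharp_real !mulcJ_cmod2 => /eqP; rewrite subr_eq0 => /eqP[/eqP].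
by rewrite eqrXn2 ?sqrtr_ge0// => /eqP.
Qed.

(** [derive1] is a total operator; the differentiability from [PW_derive] shows that [rderiv] takes
    the values of a genuine derivative. *)
Lemma PW_rderiv gam f : PW gam f -> exists f', PW_deriv_pair gam f f' /\
  forall x, rderiv f x = f' x%:C%C.
Proof.
move=> Pf; have [f' [Pf' df]] := PW_derive Pf; exists f'; split.
  by split=> // x; case: (df x).
move=> x; have [[_ dr] [_ di]] := df x.
by rewrite /rderiv !derive1E dr di; apply: complex_ext; simpc.
Qed.

End PhaseRetrieval.

Theorem theorem2p10 (R : realType) (t : int -> R) :
  sampling_set (2 * pi) t ->
  forall f g : R[i] -> R[i], PW pi f -> PW pi g ->
    (forall n : int, cmod (f (t n)%:C%C) = cmod (g (t n)%:C%C)) ->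
    (forall n : int, cmod (rderiv f (t n)) = cmod (rderiv g (t n))) ->
    exists lam : R[i], cmod lam = 1 /\
      ((forall z, f z = lam * g z) \/ (forall z, f z = lam * fsharp g z)).
Proof.
(* Writing 2 pi as pi + pi matches the support of a product given by [PWM]. *)
rewrite mulr_natl mulr2n => samp f g Pf Pg fgt fgt'.
have [f' [pf f'E]] := PW_rderiv Pf; have [g' [pg g'E]] := PW_rderiv Pg.
have [_ Pf' fr fi] := pf; have [_ Pg' gr gi] := pg.
have fg := sampling_cmod samp Pf Pg fgt.
have fg' : forall x, cmod (f' x%:C%C) = cmod (g' x%:C%C).
  by apply: sampling_cmod samp Pf' Pg' _ => n; rewrite -f'E -g'E.
pose u z := f' z * fsharp f z; pose v z := g' z * fsharp g z.
have Pu := PWM Pf' (PW_sharp Pf); have Pv := PWM Pg' (PW_sharp Pg).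
have uE x : u x%:C%C = f' x%:C%C * conjc (f x%:C%C) by rewrite /u fsharp_real.
have vE x : v x%:C%C = g' x%:C%C * conjc (g x%:C%C) by rewrite /v fsharp_real.
have Reuv x : complex.Re (u x%:C%C) = complex.Re (v x%:C%C).
  have d2 (p q : R -> R) p' q' : is_derive x 1 p p' -> is_derive x 1 q q' ->
      is_derive x 1 (fun x => p x ^+ 2 + q x ^+ 2) (2 * (p' * p x + q' * q x)).
    move=> dp dq; have := is_deriveD (is_deriveX 2 dp) (is_deriveX 2 dq).
    by move/is_derive_eq; apply; rewrite /GRing.scale/= !expr1; ring.
  have [_ df2] := d2 _ _ _ _ (fr x) (fi x); have [_ dg2] := d2 _ _ _ _ (gr x) (gi x).
  have E : (fun y : R => complex.Re (f y%:C%C) ^+ 2 + complex.Im (f y%:C%C) ^+ 2) =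
      (fun y => complex.Re (g y%:C%C) ^+ 2 + complex.Im (g y%:C%C) ^+ 2).
    by apply/funext => y; rewrite -!cmod2E fg.
  by move: df2; rewrite E dg2 uE vE !cReM !cReJ !cImJ => h; lra.
have Imuv x : complex.Im (u x%:C%C) ^+ 2 = complex.Im (v x%:C%C) ^+ 2.
  (* On the real line |u| = |f'| |f| = |g'| |g| = |v|; removing the equal real parts leaves the
     squared imaginary parts. *)
  have /eqP : cmod (u x%:C%C) ^+ 2 = cmod (v x%:C%C) ^+ 2.
    by rewrite uE vE !cmodM fg' /cmod !cReJ !cImJ !sqrrN -!/(cmod _) fg.
  by rewrite !cmod2E Reuv => /eqP/addrI.
have subJ (w : R[i] -> R[i]) x : w x%:C%C - fsharp w x%:C%C =
    (0 +i* (2 * complex.Im (w x%:C%C)))%C.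
  by apply: complex_ext; rewrite ?cReD ?cImD ?cReN ?cImN fsharp_real ?cReJ ?cImJ; simpl; ring.
(* On the real line these two elements are 2i (Im u - Im v) and 2i (Im u + Im v), so their product
   vanishes there. *)
have Pp := PWB (PWB Pu (PW_sharp Pu)) (PWB Pv (PW_sharp Pv)).
have Pq := PWD (PWB Pu (PW_sharp Pu)) (PWB Pv (PW_sharp Pv)).
have [x|p0|q0] := PW_mul_eq0 Pp Pq.
- rewrite (subJ u) (subJ v); simpc.
  by congr Complex; have := Imuv x; nra.
- have [|lam [lam1 fl]] := PW_proportional pf pg fg.
    move=> x; rewrite -uE -vE; apply: complex_ext => //.
    have := p0 x; rewrite (subJ u) (subJ v); simpc => -[]; lra.
  by exists lam; split=> //; left.
(* Here Im u = - Im v, so u = conj(v) on the real line, and conj(v) = conj(g') g is the product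
   formed by the derivative of g# and the conjugate of g#. *)
- have fgs x : cmod (f x%:C%C) = cmod (fsharp g x%:C%C).
    by rewrite fg fsharp_real /cmod cReJ cImJ sqrrN.
  have [|lam [lam1 fl]] := PW_proportional pf (PW_deriv_pair_sharp pg) fgs.
    move=> x; rewrite !fsharp_real -uE conjcK.
    have {}vE : conjc (g' x%:C%C) * g x%:C%C = conjc (v x%:C%C).
      by rewrite vE rmorphM; congr (_ * _); exact/esym/conjcK.
    rewrite vE; apply: complex_ext; rewrite ?cReJ ?cImJ//.
    have := q0 x; rewrite (subJ u) (subJ v); simpc => -[]; lra.
  by exists lam; split=> //; right.
Qed.
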